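(* Let $p>0$ and let $0<a\le \exp(-1)$. For $\alpha>0$ and $\lambda\in(0,a]$ let $$r_\alpha(\lambda)=\frac{(1-\lambda^{\sqrt{\alpha}})^2}{\lambda+(1-\lambda^{\sqrt{\alpha}})^2},\qquad f_p(\lambda)=(-\ln\lambda)^{-p}.$$ Then the regularization method with generator function $g_\alpha(\lambda)=\dfrac{1}{\lambda+(1-\lambda^{\sqrt{\alpha}})^2}$ has qualification $f_p$, that is, $$\sup_{0<\lambda\le a}|r_\alpha(\lambda)|\,f_p(\lambda)=\mathcal{O}\big(f_p(\alpha)\big)\quad\text{as }\alpha\downarrow 0.$$
   Context: The residual function of a generator function $g_\alpha$ is $r_\alpha(\lambda)=1-\lambda g_\alpha(\lambda)$. ''Has qualification $f_p$'' means exactly the displayed estimate: there is a constant $C$, independent of $\alpha$, with $\sup_{0<\lambda\le a}|r_\alpha(\lambda)|f_p(\lambda)\le C f_p(\alpha)$ for all sufficiently small $\alpha>0$. *)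

(* Defs.v *)
From HB Require Import structures.
From mathcomp Require Import all_boot all_order all_algebra.
From mathcomp Require Import all_classical all_reals all_analysis.

Set Implicit Arguments.
Unset Strict Implicit.
Unset Printing Implicit Defensive.

Import Order.TTheory GRing.Theory Num.Theory.
Import numFieldNormedType.Exports.

Local Open Scope classical_set_scope.
Local Open Scope ring_scope.

Definition residual {R : realType} (g : R -> R -> R) (alpha lambda : R) : R :=
  1 - lambda * g alpha lambda.

(* Taken in the extended reals: [sup] on R would be 0 on an unbounded set. *)
Definition weighted_sup {R : realType} (a : R) (r f : R -> R) : \bar R :=
  ereal_sup [set (`|r lambda| * f lambda)%:E | lambda in `]0, a]].

Definition sup_residual_bigO {R : realType} (a : R) (r : R -> R -> R)
    (f : R -> R) : Prop :=
  exists C : R, \forall alpha \near 0^'+,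
    (weighted_sup a (r alpha) f <= (C * f alpha)%:E)%E.

Definition has_qualification {R : realType} (a : R) (g : R -> R -> R)
    (f : R -> R) : Prop :=
  sup_residual_bigO a (residual g) f.

Definition gen {R : realType} (alpha lambda : R) : R :=
  (lambda + (1 - lambda `^ Num.sqrt alpha) ^+ 2)^-1.

Definition resid {R : realType} (alpha lambda : R) : R :=
  (1 - lambda `^ Num.sqrt alpha) ^+ 2
    / (lambda + (1 - lambda `^ Num.sqrt alpha) ^+ 2).

Definition log_index {R : realType} (p lambda : R) : R :=
  (- ln lambda) `^ (- p).

(* Main.v *)
Require Import Defs.
From HB Require Import structures.
From mathcomp Require Import all_boot all_order all_algebra.
From mathcomp Require Import all_classical all_reals all_analysis.
From mathcomp Require Import ring lra.

Import Order.TTheory GRing.Theory Num.Theory.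
Import numFieldNormedType.Exports.

Local Open Scope classical_set_scope.
Local Open Scope ring_scope.

(** Put [s = - ln lambda], which is at least [1], and [L = - ln alpha].  The
    residual function is [w ^ 2 / (lambda + w ^ 2)] with
    [w = 1 - expR (- sqrt alpha * s)], so it is at most [1], and it is also at
    most [w ^ 2 / lambda <= alpha * s ^ 2 / lambda = s ^ 2 * expR (s - L)]
    because [0 <= w <= sqrt alpha * s].  The two bounds are separated by the
    threshold [s = L / 2], that is [lambda = sqrt alpha].

    For [s >= L / 2] the weight alone is small enough:
    [s `^ (- p) <= 2 `^ p * L `^ (- p)], and the residual is at most [1].
    For [s < L / 2] the weight is at most [1], since [s >= 1], and the residual
    is at most [L ^ 2 * expR (- L / 2)], which decays exponentially in [L] and
    so is at most a constant times [L `^ (- p)] ([powR_le_expR_half]).  The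
    resulting constant does not depend on [alpha] or [lambda], and the estimate
    holds for every [alpha] in [(0, 1)] ([resid_log_index_le]). *)

(** [ln (y / (2 * q)) <= y / (2 * q)], multiplied by [q] and exponentiated. *)
Lemma powR_le_expR_half (R : realType) (q y : R) : 0 < q -> 0 < y ->
  y `^ q <= (2 * q) `^ q * expR (y / 2).
Proof.
move=> q0 y0.
have q20 : 0 < 2 * q by rewrite mulr_gt0.
have lny : ln y <= y / (2 * q) + ln (2 * q).
  rewrite -lerBlDr -ln_div ?posrE//.
  have := @expR_ge1Dx R (ln (y / (2 * q))).
  by rewrite lnK ?posrE ?divr_gt0//; lra.
rewrite /powR !gt_eqF// -expRD ler_expR.
have -> : y / 2 = q * (y / (2 * q)) by field; rewrite gt_eqF.
by rewrite -mulrDr addrC ler_pM2l.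
Qed.

Lemma residual_genE (R : realType) (alpha lambda : R) : 0 < lambda ->
  residual gen alpha lambda = resid alpha lambda.
Proof.
move=> l0; rewrite /residual /gen /resid.
have := sqr_ge0 (1 - lambda `^ Num.sqrt alpha).
set w := _ ^+ 2 => w0.
by field; rewrite gt_eqF// ltr_wpDr.
Qed.

Lemma resid_ge0 (R : realType) (alpha lambda : R) : 0 < lambda ->
  0 <= resid alpha lambda.
Proof. by move=> l0; rewrite divr_ge0 ?addr_ge0 ?sqr_ge0// ltW. Qed.

Lemma resid_le1 (R : realType) (alpha lambda : R) : 0 < lambda ->
  resid alpha lambda <= 1.
Proof.
move=> l0; rewrite /resid ler_pdivrMr ?ltr_wpDr ?sqr_ge0//.
by rewrite mul1r lerDr ltW.
Qed.

(** The bound [1 - lambda `^ t <= - t * ln lambda], from the convexity of the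
    exponential, is what makes the residual small when [lambda] is not too
    small compared with [alpha]. *)
Lemma resid_le_sqr_ln (R : realType) (alpha lambda : R) :
  0 < alpha -> 0 < lambda <= 1 ->
  resid alpha lambda <= (- ln lambda) ^+ 2 * alpha / lambda.
Proof.
move=> al0 /andP[l0 l1]; rewrite /resid.
set t := Num.sqrt alpha; set w := 1 - lambda `^ t.
have t0 : 0 <= t by exact: sqrtr_ge0.
have lnl : ln lambda <= 0 by exact: ln_le0.
have w0 : 0 <= w.
  rewrite subr_ge0 /powR gt_eqF// -expR0 ler_expR; nra.
have wle : w <= - ln lambda * t.
  rewrite /w /powR gt_eqF//.
  have := @expR_ge1Dx R (t * ln lambda); lra.
have w2 : w ^+ 2 <= (- ln lambda) ^+ 2 * alpha.
  have <- : t ^+ 2 = alpha by rewrite sqr_sqrtr ?ltW.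
  by rewrite -exprMn ler_sqr// nnegrE (le_trans w0).
have lw0 : 0 < lambda + w ^+ 2 by rewrite ltr_wpDr ?sqr_ge0.
apply: ler_pM => //; [exact: sqr_ge0 | by rewrite invr_ge0 ltW |].
by rewrite lef_pV2 ?posrE// lerDl sqr_ge0.
Qed.

(** The constant is the sum of those from the two regimes; the exponent [p + 2]
    absorbs the factor [L ^ 2] that is left over when [lambda] is above
    [sqrt alpha]. *)
Lemma resid_log_index_le (R : realType) (p alpha lambda : R) : 0 < p ->
  0 < alpha < 1 -> 0 < lambda <= expR (- 1) ->
  resid alpha lambda * log_index p lambda <=
  (2 `^ p + (2 * (p + 2)) `^ (p + 2)) * log_index p alpha.
Proof.
move=> p0 /andP[al0 al1] /andP[l0 l1]; rewrite /log_index.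
have l1' : lambda <= 1.
  by rewrite (le_trans l1)// -expR0 ler_expR lerN10.
have r0 := @resid_ge0 R alpha lambda l0.
have r1 := @resid_le1 R alpha lambda l0.
have := @resid_le_sqr_ln R alpha lambda al0.
rewrite l0 l1' => /(_ isT).
set L := - ln alpha; set s := - ln lambda => rs.
have s1 : 1 <= s.
  by rewrite /s lerNr -(expRK (- 1)) ler_ln ?posrE ?expR_gt0.
have L0 : 0 < L by rewrite oppr_gt0 ln_lt0// al0.
have s0 : 0 < s by exact: lt_le_trans s1.
have Lp0 : 0 < L `^ p by exact: powR_gt0.
have sp0 : 0 < s `^ p by exact: powR_gt0.
have c1 : 0 <= 2 `^ p :> R by exact: powR_ge0.
have c2 : 0 <= (2 * (p + 2)) `^ (p + 2) by exact: powR_ge0.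
rewrite !powRN mulrDl.
have [sL|sL] := leP (L / 2) s.
- apply: ler_wpDr; first by rewrite mulr_ge0 // invr_ge0 ltW.
  apply: (@le_trans _ _ (s `^ p)^-1); first by rewrite ler_piMl// invr_ge0 ltW.
  rewrite -ler_pdivrMl ?powR_gt0// -invfM lef_pV2 ?posrE ?mulr_gt0 ?powR_gt0//.
  rewrite -powRM//; last exact: ltW.
  by apply: ge0_ler_powR; rewrite ?nnegrE; lra.
- apply: ler_wpDl; first by rewrite mulr_ge0 // invr_ge0 ltW.
  have sp1 : (s `^ p)^-1 <= 1.
    by rewrite invf_le1// -(powRr0 s) ler_powR// ltW.
  apply: (@le_trans _ _ (L ^+ 2 * expR (- (L / 2)))).
    apply: (le_trans (y := s ^+ 2 * alpha / lambda)).
      by rewrite (le_trans _ rs)// ler_piMr.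
    have -> : s ^+ 2 * alpha / lambda = s ^+ 2 * expR (s - L).
      by rewrite -mulrA opprK expRD expRN !lnK ?posrE// [_^-1 * _]mulrC.
    apply: ler_pM; rewrite ?sqr_ge0 ?expR_ge0//.
      by rewrite ler_sqr ?nnegrE; lra.
    by rewrite ler_expR; lra.
  have := @powR_le_expR_half R (p + 2) L.
  move=> /(_ ltac:(lra) L0).
  rewrite powRD; last by rewrite (gt_eqF L0) implybT.
  rewrite powR_mulrn ?(ltW L0)// => h.
  rewrite expRN ler_pdivlMr// mulrAC ler_pdivrMr ?expR_gt0//.
  by rewrite mulrC.
Qed.

Theorem proposition2 (R : realType) (p a : R)
    (hp : 0 < p) (ha0 : 0 < a) (ha : a <= expR (- 1)) :
  [/\ forall alpha lambda : R, 0 < alpha -> 0 < lambda <= a ->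
        residual gen alpha lambda = resid alpha lambda,
      has_qualification a gen (log_index p)
    & sup_residual_bigO a resid (log_index p)].
Proof.
have bigO : sup_residual_bigO a resid (log_index p).
  exists (2 `^ p + (2 * (p + 2)) `^ (p + 2)); near=> alpha.
  have al0 : 0 < alpha by near: alpha; exact: nbhs_right_gt.
  have al1 : alpha < 1 by near: alpha; exact: nbhs_right_lt.
  apply: ge_ereal_sup => _ [lambda /= + <-]; rewrite in_itv/= => /andP[l0 la].
  rewrite lee_fin ger0_norm ?resid_ge0//.
  by rewrite resid_log_index_le ?al0 ?l0 ?(le_trans la).
split=> //.
  by move=> alpha lambda _ /andP[l0 _]; exact: residual_genE.
have [C HC] := bigO; exists C.
apply: filterS HC => alpha; apply: le_trans.
rewrite le_eqVlt; apply/orP; left; apply/eqP; congr ereal_sup.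
apply: eq_imagel => lambda /=; rewrite in_itv/= => /andP[l0 _].
by rewrite residual_genE.
Unshelve. all: by end_near. Qed.
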